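(* Let $S\subset\mathbb N_0$ be nonempty, $\theta\in(0,1)$, and let $\phi\in C^\theta(X_S)$ be renewal-type with induced one-symbol potential $\psi:S\to\mathbb R$. The equation $$\sum_{n\in S}e^{\psi(n)-P(n+1)}=1$$ has a unique real solution $P$. If $S$ is infinite, then this solution satisfies $P>\phi(0^\infty)$.
   Context: $\mathbb N_0=\{0,1,2,\dots\}$. For nonempty $S\subset\mathbb N_0$, the one-sided $S$-gap shift $X_S\subset\{0,1\}^{\mathbb N_0}$ is the set of all $x=(x_k)_{k\ge0}$ such that whenever two consecutive (i.e. successive) symbols $1$ occur in $x$, the number of zeros between them belongs to $S$; it contains $0^\infty=000\cdots$, and $\sigma$ is the left shift. For $\theta\in(0,1)$ put $d_\theta(x,y)=\theta^{t(x,y)}$, $t(x,y)=\min\{k\ge0:x_k\ne y_k\}$, $d_\theta(x,x)=0$. $C^\theta(X_S)$ is the space of bounded real functions with $\|f\|_\theta=\|f\|_\infty+|f|_\theta<\infty$, where $|f|_\theta=\sup_{x\ne y}|f(x)-f(y)|/d_\theta(x,y)$. Let $Y_S=S^{\mathbb N_0}$, $\pi(y)=10^{y_0}10^{y_1}10^{y_2}\cdots\in X_S$ and $\tau(y)=y_0+1$ for $y\in Y_S$. A potential $\phi\in C^\theta(X_S)$ is renewal-type, with induced one-symbol potential $\psi:S\to\mathbb R$, if $\sum_{j=0}^{\tau(y)-1}\phi(\sigma^j\pi(y))=\psi(y_0)$ for all $y\in Y_S$. *)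

(* Defs.v *)
From HB Require Import structures.
From mathcomp Require Import all_boot all_order all_algebra.
From mathcomp Require Import all_classical all_reals all_analysis.

Set Implicit Arguments.
Unset Strict Implicit.
Unset Printing Implicit Defensive.

Import Order.TTheory GRing.Theory Num.Theory.
Local Open Scope classical_set_scope.
Local Open Scope ring_scope.

(* The symbols 0 and 1 are [false] and [true]. *)
Definition gap_shift (S : set nat) : set (nat -> bool) :=
  [set x : nat -> bool | forall i j : nat, (i < j)%N -> x i -> x j ->
     (forall k : nat, (i < k < j)%N -> ~~ x k) -> S (j - i.+1)%N].

Lemma left_shift_gap_shift (S : set nat) (x : nat -> bool) :
  gap_shift S x -> gap_shift S (fun n => x n.+1).
Proof.
move=> Sx i j ij xi xj xk; rewrite -subSS; apply: Sx => // -[|k] // /xk.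
exact.
Qed.

Definition left_shift (S : set nat) (x : gap_shift S) : gap_shift S :=
  SigSub (mem_set (left_shift_gap_shift (set_valP x))).

Lemma zeros_gap_shift (S : set nat) : gap_shift S (fun=> false).
Proof. by []. Qed.

Definition zeros (S : set nat) : gap_shift S :=
  SigSub (mem_set (@zeros_gap_shift S)).

(* Position at which the block 1 0^(y_k) starts in 1 0^(y_0) 1 0^(y_1) ... *)
Definition block_start (S : set nat) (y : nat -> S) (k : nat) : nat :=
  (\sum_(i < k) (\val (y i)).+1)%N.

Definition block_seq (S : set nat) (y : nat -> S) (n : nat) : bool :=
  `[< exists k : nat, n = block_start y k >].

Lemma block_seq_gap_shift (S : set nat) (y : nat -> S) :
  gap_shift S (block_seq y).
Proof.
have startS k : block_start y k.+1 = (block_start y k + (\val (y k)).+1)%N.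
  by rewrite /block_start big_ord_recr.
have start_mono k l : (k <= l)%N -> (block_start y k <= block_start y l)%N.
  elim: l => [|l IH]; first by rewrite leqn0 => /eqP ->.
  rewrite leq_eqVlt => /predU1P[->//|]; rewrite ltnS => /IH kl.
  by rewrite startS (leq_trans kl) ?leq_addr.
move=> i j + /asboolP[k ik] /asboolP[l jl]; rewrite {i}ik {j}jl => kl gap.
have {}kl : (k < l)%N.
  by rewrite ltnNge; apply/negP => /start_mono; rewrite leqNgt kl.
have Ek : block_start y k.+1 = block_start y l.
  apply/eqP; rewrite eqn_leq start_mono//= leqNgt; apply/negP => lt.
  have : ~~ block_seq y (block_start y k.+1).
    by apply: gap; rewrite lt startS -addSnnS leq_addr.
  by move/negP; apply; apply/asboolP; exists k.+1.
by rewrite -Ek startS addnS subSS addnC addnK; exact: set_valP.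
Qed.

Definition block_code (S : set nat) (y : nat -> S) : gap_shift S :=
  SigSub (mem_set (@block_seq_gap_shift S y)).

Definition return_time (S : set nat) (y : nat -> S) : nat := (\val (y 0%N)).+1.

Section holder_space.
Context {R : realType} (S : set nat) (theta : R).

Definition theta_dist (x y : gap_shift S) : R :=
  match pselect (exists k : nat, \val x k != \val y k) with
  | left h => theta ^+ ex_minn h
  | right _ => 0
  end.

Local Open Scope ereal_scope.

Definition norm_oo (f : gap_shift S -> R) : \bar R :=
  ereal_sup [set `|f x|%:E | x in [set: gap_shift S]].

Definition theta_seminorm (f : gap_shift S -> R) : \bar R :=
  ereal_sup [set (`|f p.1 - f p.2| / theta_dist p.1 p.2)%:E
            | p in [set p : gap_shift S * gap_shift S | p.1 <> p.2]].

Definition theta_norm (f : gap_shift S -> R) : \bar R :=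
  norm_oo f + theta_seminorm f.

Definition holder_space : set (gap_shift S -> R) :=
  [set f | theta_norm f < +oo].

End holder_space.

Definition renewal_type {R : realType} (S : set nat) (phi : gap_shift S -> R)
    (psi : S -> R) : Prop :=
  forall y : nat -> S,
    \sum_(0 <= j < return_time y) phi (iter j (@left_shift S) (block_code y))
    = psi (y 0%N).

(* Main.v *)
Require Import Defs.
From mathcomp Require Import all_boot all_order all_algebra.
From mathcomp Require Import all_classical all_reals all_analysis.
From mathcomp Require Import finmap lra zify.
Import Order.TTheory GRing.Theory Num.Theory.
Import numFieldNormedType.Exports.
Local Open Scope classical_set_scope.
Local Open Scope ring_scope.

(** Write [a] for the value of [phi] at the zero sequence.  In the orbit segment
    of [1 0^n 1 ...] summed by [psi n], the [j]-th point starts with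
    [n + 1 - j] zeros for [0 < j <= n], so its [phi]-value is within
    [L theta^(n + 1 - j)] of [a], where [L] is a Hoelder constant; the point
    [j = 0] costs at most [L].  The errors form a geometric sum, hence
    [psi n = a (n + 1) + O(1)] uniformly in [n] (induced_potential_bound), and
    the series [F P] of the equation is comparable, up to constant factors,
    with the sum over [n] in [S] of [exp ((a - P) (n + 1))].  So [F] is finite
    on [(a, +oo)] (gap_series_fin), and when [S] is infinite it is infinite
    everywhere else, because its terms are then bounded below by a positive
    constant (gap_series_gt).  This last fact alone yields [a < P] for the
    solution.

    Existence and uniqueness concern a general series [F P] of terms
    [exp (c t - P w t)] with [w >= 1] that is finite somewhere, and finite at
    some point to the left of every [P] with [F P <= 1].  The factor [w >= 1]
    makes [F] decay at least like [exp (- P)] (pressure_series_shift), which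
    gives uniqueness and, from a point where [F] is finite, an element of the
    set [E] of all [Q] with [F Q <= 1]; one single term bounds [E] from below.  The candidate solution is [inf E].  As a supremum
    of continuous finite sums, [F] is lower semicontinuous, so
    [F (inf E) <= 1] (pressure_series_le1_inf).  If the inequality were strict,
    convexity of [F] along the segment from [inf E] to some point on its left
    where [F] is finite would produce an element of [E] below [inf E]
    (pressure_series_eq1).  Such a point on the left exists: for infinite [S]
    finiteness at [inf E] forces [a < inf E], and for finite [S] the series is
    finite everywhere. *)

(** * Series of decaying exponentials *)

(** All estimates below are made on finite sums of real numbers; this
    equivalence transfers them to the extended-real sum. *)
Lemma esum_le_fset {R : realType} {T : choiceType} (f : T -> R) (M : R) :
  (\esum_(t in [set: T]) (f t)%:E <= M%:E)%E <->
  forall X : {fset T}, \sum_(t <- X) f t <= M.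
Proof.
split=> [fM X|fM].
  rewrite -lee_fin (le_trans _ fM)//; apply: esum_ge; exists [set` X].
    by split.
  by rewrite fsbig_finite//= set_fsetK sumEFin.
apply: ge_ereal_sup => _ [X [finX _] <-].
by rewrite fsbig_finite//= sumEFin lee_fin.
Qed.

Definition pressure_series {R : realType} {T : choiceType} (c w : T -> R)
  (P : R) : \bar R := \esum_(t in [set: T]) (expR (c t - P * w t))%:E.

Section pressure_equation.
Context {R : realType} {T : choiceType} {c w : T -> R}.
Context (w_ge1 : forall t, 1 <= w t).

Local Notation F := (pressure_series c w).

Lemma pressure_series_ge0 P : (0 <= F P)%E.
Proof. by apply: esum_ge0 => t _; rewrite lee_fin expR_ge0. Qed.

Lemma pressure_series_fin P : (F P < +oo)%E -> F P = (fine (F P))%:E.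
Proof. by move=> ?; rewrite fineK// ge0_fin_numE// pressure_series_ge0. Qed.

(** Each term is multiplied by [exp (- s w t)], and [s <= s w t]. *)
Lemma pressure_series_shift (P s M : R) : 0 <= s ->
  (F P <= M%:E)%E -> (F (P + s) <= (expR (- s) * M)%:E)%E.
Proof.
move=> s0 /esum_le_fset FM; apply/esum_le_fset => X.
rewrite (le_trans _ (ler_wpM2l (expR_ge0 _) (FM X)))// mulr_sumr.
apply: ler_sum => t _; rewrite -expRD ler_expR.
by have := ler_peMr s0 (w_ge1 t); lra.
Qed.

(** Inherited termwise from the exponential. *)
Lemma pressure_series_convex (P Q s A B : R) : 0 <= s <= 1 ->
  (F P <= A%:E)%E -> (F Q <= B%:E)%E ->
  (F (s * P + (1 - s) * Q) <= (s * A + (1 - s) * B)%:E)%E.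
Proof.
move=> /andP[s0 s1] /esum_le_fset FA /esum_le_fset FB; apply/esum_le_fset => X.
have s1' : 0 <= 1 - s by lra.
rewrite (le_trans _ (lerD (ler_wpM2l s0 (FA X)) (ler_wpM2l s1' (FB X))))//.
rewrite !mulr_sumr -big_split/=; apply: ler_sum => t _.
have := convex_expR (Itv01 s0 s1) (c t - P * w t) (c t - Q * w t).
rewrite !convRE/= /unstable.onem; apply: le_trans.
by rewrite ler_expR; lra.
Qed.

(** Lower semicontinuity in the form needed for an infimum: if a finite partial
    sum exceeded 1 at [inf E], by continuity it would still do so slightly to
    the right, where [E] has points. *)
Lemma pressure_series_le1_inf (E : set R) : has_inf E ->
  (forall Q, E Q -> (F Q <= 1)%E) -> (F (inf E) <= 1)%E.
Proof.
move=> infE E1; apply/esum_le_fset => X; rewrite leNgt; apply/negP => gt1.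
pose G Q := \sum_(t <- X) expR (c t - Q * w t).
have cG : {for inf E, continuous G}.
  rewrite /G; apply: cvg_big => [|t _]; first exact: add_continuous.
  apply: continuous_comp; last exact: continuous_expR.
  by apply: cvgB; [exact: cvg_cst | apply: cvgMl; exact: cvg_id].
have /cG[/= e e0 Ge] : nbhs (G (inf E)) [set z | 1 < z].
  by apply: open_nbhs_nbhs; split => //; exact: open_gt.
have [Q EQ QE] := inf_adherent e0 infE.
have /E1/esum_le_fset/(_ X) := EQ; rewrite leNgt => /negP; apply.
apply: (Ge Q); rewrite /ball/= ltr_norml.
by have := ge_inf infE.2 EQ; lra.
Qed.

Lemma pressure_series_uniq (P Q : R) : F P = 1%E -> F Q = 1%E -> P = Q.
Proof.
have H (A B : R) : F A = 1%E -> F B = 1%E -> B <= A.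
  move=> FA FB; rewrite leNgt; apply/negP => AB.
  have s0 : 0 <= B - A by lra.
  have := pressure_series_shift A (B - A) 1 s0.
  rewrite FA subrKC FB mulr1 => /(_ (lexx _)).
  by rewrite lee_fin leNgt expR_lt1 => /negP; apply; lra.
by move=> FP FQ; apply/le_anti; rewrite !H.
Qed.

(** The solution is the infimum of the points where the series is at most 1.
    Finiteness to the left is what excludes a jump over the value 1: a series
    may drop from [+oo] to a value below 1 at the edge of its domain. *)
Lemma pressure_series_eq1 (t0 : T) (Q0 : R) : (F Q0 < +oo)%E ->
  (forall P, (F P <= 1)%E -> exists2 Q, Q < P & (F Q < +oo)%E) ->
  exists P, F P = 1%E.
Proof.
move=> FQ0 left_fin; pose E := [set Q | (F Q <= 1)%E].
have infE : has_inf E.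
  split.
    (* with b = F Q0, F (Q0 + b) <= exp (- b) * b <= 1, since b <= exp b *)
    pose b := fine (F Q0).
    have b0 : 0 <= b by rewrite fine_ge0// pressure_series_ge0.
    exists (Q0 + b); rewrite /E/=.
    have := pressure_series_shift Q0 b b b0.
    rewrite -pressure_series_fin// => /(_ (lexx _)) /le_trans; apply.
    rewrite lee_fin expRN mulrC ler_pdivrMr ?expR_gt0// mul1r.
    by rewrite (le_trans _ (expR_ge1Dx b))//; lra.
  (* where F <= 1, the term at t0 is at most 1 *)
  exists (c t0 / w t0) => Q /esum_le_fset/(_ [fset t0]%fset).
  have w0 : 0 < w t0 by have := w_ge1 t0; lra.
  by rewrite big_seq_fset1 expR_le1 subr_le0 ler_pdivrMr.
exists (inf E); have F1 : (F (inf E) <= 1)%E by exact: pressure_series_le1_inf.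
have [Q QP FQ] := left_fin _ F1.
apply/eqP; rewrite eq_le F1/= leNgt; apply/negP => lt1.
have ltoo := le_lt_trans F1 (ltry 1).
set a := fine (F (inf E)); set b := fine (F Q).
have a1 : a < 1 by rewrite -lte_fin -pressure_series_fin.
have a0 : 0 <= a by rewrite fine_ge0// pressure_series_ge0.
have b0 : 0 <= b by rewrite fine_ge0// pressure_series_ge0.
(* the weight solves s * (1 + b) = 1 - a, so that s * b + (1 - s) * a <= 1 *)
pose s := (1 - a) / (1 + b).
have s0 : 0 < s by rewrite divr_gt0//; lra.
have sb : s * (1 + b) = 1 - a by rewrite divfK// gt_eqF//; lra.
have s1 : s <= 1 by rewrite ler_pdivrMr; lra.
have : E (s * Q + (1 - s) * inf E).
  have s01 : 0 <= s <= 1 by rewrite ltW.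
  have := pressure_series_convex Q (inf E) s b a s01.
  rewrite -!pressure_series_fin// => /(_ (lexx _) (lexx _)) /le_trans; apply.
  rewrite lee_fin.
  have : s * b <= 1 - a by lra.
  have := mulr_ge0 (ltW s0) a0; lra.
move=> /(ge_inf infE.2); rewrite leNgt => /negP; apply.
have : 0 < s * (inf E - Q) by rewrite mulr_gt0// subr_gt0.
lra.
Qed.

End pressure_equation.

(** * Variation of the potential along a renewal block *)

Lemma theta_dist_le {R : realType} {S : set nat} {theta : R} (x y : gap_shift S)
    (k : nat) : 0 < theta < 1 ->
  (forall i, (i < k)%N -> \val x i = \val y i) ->
  theta_dist theta x y <= theta ^+ k.
Proof.
move=> /andP[t0 t1] xy; rewrite /theta_dist; case: pselect => [h|_].
  case: ex_minnP => m xym _; apply: ler_wiXn2l; rewrite ?ltW//.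
  by rewrite leqNgt; apply/negP => /xy/eqP; apply/negP.
by rewrite exprn_ge0// ltW.
Qed.

Lemma theta_dist_gt0 {R : realType} {S : set nat} {theta : R} (x y : gap_shift S) :
  0 < theta -> x <> y -> 0 < theta_dist theta x y.
Proof.
move=> t0 xy; rewrite /theta_dist; case: pselect => [h|nh].
  by rewrite exprn_gt0.
exfalso; apply: xy; apply: val_inj; apply/funext => k; apply/eqP.
by apply: contrapT => /negP xyk; apply: nh; exists k.
Qed.

(** The norm is a sum in the extended reals, where [+oo - oo = -oo]: its
    finiteness bounds the seminorm only because the supremum norm is not [-oo],
    the shift space being nonempty. *)
Lemma holder_spaceP {R : realType} {S : set nat} {theta : R}
    {phi : gap_shift S -> R} :
  0 < theta -> holder_space theta phi ->
  exists2 L, 0 <= L & forall x y, `|phi x - phi y| <= L * theta_dist theta x y.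
Proof.
move=> t0; rewrite /holder_space/= /theta_norm => norm_fin.
have oo_gt : (-oo < norm_oo phi)%E.
  rewrite (@lt_le_trans _ _ (`|phi (zeros S)|%:E))%E ?ltNyr//.
  by apply: ereal_sup_ubound; exists (zeros S).
have semi_fin : (theta_seminorm theta phi < +oo)%E.
  rewrite ltey; apply/eqP => semi_oo; move: norm_fin; rewrite semi_oo.
  by case: norm_oo oo_gt.
have [L /andP[L0 semiL]] : exists L, (0 <= L) && (theta_seminorm theta phi <= L%:E)%E.
  case: theta_seminorm semi_fin => [r _||_]//.
    by exists (Num.max r 0); rewrite le_max lexx orbT lee_fin le_max lexx.
  by exists 0; rewrite lexx leNye.
exists L => // x y; have [->|/eqP xy] := eqVneq x y.
  rewrite subrr normr0 mulr_ge0// /theta_dist; case: pselect => // h.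
  by rewrite exprn_ge0// ltW.
rewrite -ler_pdivrMr ?theta_dist_gt0// -lee_fin (le_trans _ semiL)//.
by apply: ereal_sup_ubound; exists (x, y).
Qed.

Lemma iter_left_shiftE {S : set nat} (x : gap_shift S) (j i : nat) :
  \val (iter j (@left_shift S) x) i = \val x (i + j)%N.
Proof.
elim: j i => [|j IH] i; first by rewrite addn0.
by rewrite iterS -addSnnS -IH.
Qed.

Lemma block_code_first_gap {S : set nat} (y : nat -> S) (i : nat) :
  (0 < i < return_time y)%N -> \val (block_code y) i = false.
Proof.
move=> /andP[i0 iy]; apply/asboolP => -[[|k]]; rewrite /block_start.
  by rewrite big_ord0 => i_eq0; rewrite i_eq0 in i0.
by rewrite big_ord_recl => iE; move: iy; rewrite iE ltnNge leq_addr.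
Qed.

Lemma geometric_sum_le {R : realType} (theta : R) (n : nat) : 0 < theta < 1 ->
  \sum_(i < n) theta ^+ i <= (1 - theta)^-1.
Proof.
move=> /andP[t0 t1]; rewrite -[leRHS]mul1r ler_pdivlMr ?subr_gt0//.
have := subrX1 theta n; have := exprn_ge0 n (ltW t0).
by rewrite mulrBl mulrC mul1r; lra.
Qed.

(** Shifted [j] times with [0 < j <= n], the point [1 0^n 1 ...] agrees with the
    zero sequence on its first [n + 1 - j] symbols, so the Hoelder errors sum to
    at most [L (1 + theta + ... + theta^n)]. *)
Lemma induced_potential_bound {R : realType} {S : set nat} {theta : R}
    {phi : gap_shift S -> R} {psi : S -> R} :
  0 < theta < 1 -> holder_space theta phi -> renewal_type phi psi ->
  exists C, forall n, `|psi n - phi (zeros S) * (\val n).+1%:R| <= C.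
Proof.
move=> theta01 phi_holder phi_psi.
have t0 : 0 < theta by case/andP: theta01.
have [L L0 phiL] := holder_spaceP t0 phi_holder.
(* psi n can be read off any sequence of gaps that starts with n *)
exists (L * (1 - theta)^-1) => n; pose y (_ : nat) : S := n.
rewrite -(phi_psi y) /return_time -/(\val n).
set N := (\val n).+1; rewrite mulr_natr -[N in _ *+ N]subn0 -sumr_const_nat -sumrB.
rewrite (le_trans (ler_norm_sum _ _ _))//.
have dist_le j : (j < N)%N ->
  `|phi (iter j (@left_shift S) (block_code y)) - phi (zeros S)|
    <= L * theta ^+ (if j is 0 then 0%N else (N - j)%N).
  move=> jN; rewrite (le_trans (phiL _ _))// ler_wpM2l//.
  apply: theta_dist_le => // i; case: j jN => // j jN ij.
  rewrite iter_left_shiftE block_code_first_gap//.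
  by rewrite addnS/= /return_time -/N; lia.
rewrite big_nat.
rewrite (le_trans (ler_sum _ (fun j => @dist_le j)))//.
rewrite -big_nat -mulr_sumr ler_wpM2l// (le_trans _ (geometric_sum_le theta N theta01))//.
(* the errors after the first are theta^n, ..., theta: a geometric sum reversed *)
rewrite big_nat_recl// -(big_mkord xpredT (fun i => theta ^+ i)) big_nat_recl// lerD2l.
rewrite [leRHS]big_nat_rev/= !big_nat; apply: ler_sum => j jN.
by rewrite add0n -subSn// subnS /= subSS; lia.
Qed.

(** * The series over the gaps *)

Lemma finite_set_type {S : set nat} : finite_set S -> finite_set [set: S].
Proof.
move=> finS; rewrite (_ : [set: S] = \val @^-1` S).
  by apply: finite_preimage => // ? ? _ _; exact: val_inj.
by apply/seteqP; split => // n _; exact: set_valP.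
Qed.

Lemma infinite_set_type {S : set nat} : infinite_set S -> infinite_set [set: S].
Proof.
move=> infS finS; apply: infS; rewrite (_ : S = \val @` [set: S]).
  exact: finite_image.
apply/seteqP; split => [n Sn|_ [n _ <-]]; last exact: set_valP.
by exists (SigSub (mem_set Sn)).
Qed.

Section gap_series.
Context {R : realType} {S : set nat} {a C : R} {psi : S -> R}.
Context (psiC : forall n, `|psi n - a * (\val n).+1%:R| <= C).

Local Notation F := (pressure_series psi (fun n => (\val n).+1%:R)).

(** Comparison with the geometric series of ratio [exp (a - P) < 1]. *)
Lemma gap_series_fin P : a < P -> (F P < +oo)%E.
Proof.
move=> aP; pose r := expR (a - P).
have r01 : 0 < r < 1 by rewrite expR_gt0 expR_lt1 subr_lt0.
suff /le_lt_trans : (F P <= (expR C * (1 - r)^-1)%:E)%E by apply; rewrite ltry.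
apply/esum_le_fset => X.
have termle (n : S) : expR (psi n - P * (\val n).+1%:R) <= expR C * r ^+ \val n.
  rewrite -expRM_natr -expRD ler_expR.
  have := psiC n; rewrite ler_norml => /andP[_]; rewrite -natr1.
  by move: aP; nra.
rewrite (le_trans (ler_sum _ (fun n _ => termle n)))// -mulr_sumr.
rewrite ler_wpM2l ?expR_ge0//.
pose N := (\max_(n <- X) \val n).+1.
rewrite (le_trans _ (geometric_sum_le r N r01))//.
rewrite -(big_mkord xpredT (fun i => r ^+ i)).
have -> : \sum_(n <- X) r ^+ \val n = \sum_(i <- [fset \val n | n in X]%fset) r ^+ i.
  by rewrite big_imfset//= => ? ? _ _; exact: val_inj.
rewrite -lee_fin -!sumEFin; apply: lee_sum_fset_nat => [i _|_ /imfsetP[n nX ->]].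
  by rewrite lee_fin exprn_ge0// ltW; case/andP: r01.
by rewrite /= ltnS; exact: leq_bigmax_seq.
Qed.

(** If [P <= a], every term is at least [exp (- C)], and infinitely many such
    terms have an infinite sum. *)
Lemma gap_series_gt P : infinite_set S -> (F P < +oo)%E -> a < P.
Proof.
move=> infS Ffin; rewrite ltNge; apply/negP => Pa.
pose M := fine (F P).
have FM : (F P <= M%:E)%E by rewrite -pressure_series_fin.
pose k := (Num.truncn (M / expR (- C))).+1.
have [X _ kX] := infinite_set_fset k (infinite_set_type infS).
have /esum_le_fset/(_ X) := FM; rewrite leNgt => /negP; apply.
have termge (n : S) : expR (- C) <= expR (psi n - P * (\val n).+1%:R).
  rewrite ler_expR; have := psiC n; rewrite ler_norml => /andP[+ _].
  have : 0 <= (a - P) * (\val n).+1%:R by rewrite mulr_ge0// subr_ge0.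
  lra.
rewrite (lt_le_trans _ (ler_sum _ (fun n _ => termge n)))//.
rewrite big_const_seq count_predT iter_addr_0 -mulr_natl -ltr_pdivrMr ?expR_gt0//.
rewrite (lt_le_trans (truncnS_gt _))// ler_nat.
exact: kX.
Qed.

End gap_series.

Theorem lemma3p4 (R : realType) (S : set nat) (S_neq0 : S !=set0)
    (theta : R) (theta01 : 0 < theta < 1)
    (phi : gap_shift S -> R) (phi_holder : holder_space theta phi)
    (psi : S -> R) (phi_psi : renewal_type phi psi) :
  let solves (P : R) : Prop :=
    (\esum_(n in [set: S]) (expR (psi n - P * (\val n).+1%:R))%:E = 1%:E)%E in
  exists P : R,
    [/\ solves P,
        forall Q : R, solves Q -> Q = P
      & infinite_set S -> phi (zeros S) < P].
Proof.
have [C psiC] := induced_potential_bound theta01 phi_holder phi_psi.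
set a := phi (zeros S) in psiC *.
pose w (n : S) : R := (\val n).+1%:R.
have w_ge1 n : 1 <= w n by rewrite ler1n.
case: S_neq0 => n0 Sn0; pose t0 : S := SigSub (mem_set Sn0).
have [P FP] : exists P, pressure_series psi w P = 1%E.
  apply: (pressure_series_eq1 w_ge1 t0 (a + 1)).
    by apply: (gap_series_fin psiC); rewrite ltrDl ltr01.
  move=> P P1; have Pfin := le_lt_trans P1 (ltry 1).
  have [finS|infS] := pselect (finite_set S).
    exists (P - 1); first by rewrite gtrDl oppr_lt0.
    have finT := finite_set_type finS.
    rewrite /pressure_series esum_fset//.
    by rewrite fsbig_finite// sumEFin ltry.
  have aP := gap_series_gt psiC P infS Pfin.
  exists ((a + P) / 2); first by lra.
  by apply: (gap_series_fin psiC); lra.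
exists P; split=> // [Q FQ|infS].
  exact: (pressure_series_uniq w_ge1 _ _ FQ FP).
by apply: (gap_series_gt psiC) => //; rewrite -/w FP ltry.
Qed.
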